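(* For any $\alpha\in[1,2]$, there exists a family $\{T_K\}_{K\ge 5}$ of trees such that each $T_K$ has $K$ vertices and $\text{w-sat}(T_K)=\Theta(K^{\alpha})$ (as $K\to\infty$).
   Context: All graphs are simple, finite and undirected; $v(G)$ and $e(G)$ denote the numbers of vertices and edges of a graph $G$. Given a graph $F$, a graph $G$ is weakly $F$-saturated if the non-edges of $G$ can be added one by one in some order, ending with the complete graph on $V(G)$, so that each newly added edge creates a new copy of $F$ (a subgraph isomorphic to $F$, not necessarily induced, containing the new edge). For an integer $n$, $\text{w-sat}(n,F)$ is the minimum number of edges of an $n$-vertex weakly $F$-saturated graph. For a tree $T$ with at least one edge, $\text{w-sat}(n,T)$ is constant for all sufficiently large $n$, and $\text{w-sat}(T)$ denotes this limit value $\lim_{n\to\infty}\text{w-sat}(n,T)$. *)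

(* Defs.v *)
From HB Require Import structures.
From mathcomp Require Import all_boot all_order all_algebra.
From mathcomp Require Import all_classical all_reals all_analysis.

Set Implicit Arguments.
Unset Strict Implicit.
Unset Printing Implicit Defensive.

Import Order.TTheory GRing.Theory Num.Theory.
Import numFieldNormedType.Exports.

Record sgraph (V : finType) := SGraph {
  adj :> rel V;
  adj_sym : symmetric adj;
  adj_irr : irreflexive adj }.

Definition edges (V : finType) (G : sgraph V) : {set {set V}} :=
  [set [set p.1; p.2] | p : V * V & G p.1 p.2].

Definition nb_edges (V : finType) (G : sgraph V) : nat := #|edges G|.

(* A duplicate-free closed walk of length 2 merely goes back and forth along
   an edge, so only those of length at least 3 are cycles of the graph. *)
Definition acyclic (V : finType) (G : sgraph V) : Prop :=
  forall c : seq V, ucycle G c -> (size c < 3)%N.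

Definition is_tree (V : finType) (G : sgraph V) : Prop :=
  [/\ (0 < #|V|)%N, (forall x y : V, connect G x y) & acyclic G].

Section AddEdge.
Variables (V : finType) (G : sgraph V) (u v : V).

Definition add_edge_rel : rel V :=
  [rel x y | G x y || ((x != y) && ([set x; y] == [set u; v]))].

Lemma add_edge_sym : symmetric add_edge_rel.
Proof. by move=> x y; rewrite /add_edge_rel /= adj_sym eq_sym finset.setUC. Qed.

Lemma add_edge_irr : irreflexive add_edge_rel.
Proof. by move=> x; rewrite /add_edge_rel /= adj_irr eqxx. Qed.

Definition add_edge : sgraph V := SGraph add_edge_sym add_edge_irr.

End AddEdge.

Definition copy_through (V W : finType) (F : sgraph V) (G : sgraph W)
    (u v : W) : Prop :=
  exists f : V -> W,
    [/\ injective f,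
        (forall x y : V, F x y -> G (f x) (f y)) &
        exists x y : V, [/\ F x y, f x = u & f y = v]].

(* The order in which the non-edges are added is the sequence of uses of
   [ws_add] in a derivation. *)
Inductive weakly_saturated (V W : finType) (F : sgraph V) : sgraph W -> Prop :=
| ws_complete (G : sgraph W) :
    (forall x y : W, x != y -> G x y) -> weakly_saturated F G
| ws_add (G : sgraph W) (u v : W) :
    u != v -> ~~ G u v ->
    copy_through F (add_edge G u v) u v ->
    weakly_saturated F (add_edge G u v) ->
    weakly_saturated F G.

Section CompleteGraph.
Variable V : finType.

Lemma neq_sym : symmetric [rel x y : V | x != y].
Proof. by move=> x y; rewrite /= eq_sym. Qed.

Lemma neq_irr : irreflexive [rel x y : V | x != y].
Proof. by move=> x; rewrite /= eqxx. Qed.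

Definition complete_graph : sgraph V := SGraph neq_sym neq_irr.

End CompleteGraph.

Section WSat.
Variables (n : nat) (V : finType) (F : sgraph V).

Definition wsat_size : pred nat := fun m =>
  `[< exists G : sgraph 'I_n, weakly_saturated F G /\ nb_edges G = m >].

Lemma wsat_size_ex : exists m, wsat_size m.
Proof.
exists (nb_edges (complete_graph 'I_n)); apply/asboolP.
by exists (complete_graph 'I_n); split => //; apply: ws_complete.
Qed.

Definition wsat : nat := ex_minn wsat_size_ex.

End WSat.

(* The limit of a convergent sequence of natural numbers is its eventual
   value. *)
Definition wsat_limit (V : finType) (F : sgraph V) (w : nat) : Prop :=
  \forall n \near \oo%classic, wsat n F = w.

(* Main.v *)
Require Import Defs.
From HB Require Import structures.
From mathcomp Require Import all_boot all_order all_algebra.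
From mathcomp Require Import all_classical all_reals all_analysis.
From mathcomp Require Import perm zify lra.

Set Implicit Arguments.
Unset Strict Implicit.
Unset Printing Implicit Defensive.

(** The trees are double stars: two adjacent centres, one of degree [m + 1] and
    the other of degree [K - m - 1], every other vertex being a leaf, with [m]
    about [K ^ (alpha / 2) / 4].  Up to constants, their weak saturation number lies
    between [m ^ 2] and [m ^ 2 + K].  Both bounds have order [K ^ alpha]: the first
    by the choice of [m], the second because [K <= K ^ alpha].  The condition
    [alpha <= 2] leaves room for [2 m + 2 <= K], so that the centre of degree
    [m + 1] is the smaller one.

    Lower bound.  Every edge of the double star has an end of degree at least
    [d = m + 1], so a new edge can only appear at a vertex that already has
    degree at least [d - 1].  List the vertices by the time when they first play
    this part.  Until the [i]-th one does, every added edge contains an earlier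
    vertex of the list, so it has at least [d - i] initial edges to vertices that are
    not earlier.  Summing gives at least [binomial d 2] initial edges
    ([weakly_saturated_lower_bound]).  The proof builds the list backwards, from the
    complete graph to the initial one, each step moving one vertex to the front.

    Upper bound.  Start from a clique on [m + 2] vertices, one of which, the hub,
    has further neighbours so as to have degree [K].  The hub can play the large
    centre, so it can be joined to every vertex.  Once it is adjacent to all the
    vertices, any vertex is a possible small centre as soon as it has [m]
    neighbours besides the hub, the new one included: first the vertices of the
    clique get joined to everything, then all the others follow
    ([seed_weakly_saturated]).  This costs at most [(m + 2) ^ 2 + K + 1] edges.

    Existence of the limit.  An isolated vertex added to a weakly saturated graph
    can be joined to all the others as a leaf of the tree, once they form a large
    clique.  Thus the weak saturation number eventually does not increase with
    [n], and is eventually constant ([wsat_nonincr], [nonincr_stationary]). *)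

(** * Adding edges *)

Lemma add_edge_sub (V : finType) (G : sgraph V) u v x y :
  G x y -> add_edge G u v x y.
Proof. by rewrite /= /add_edge_rel /= => ->. Qed.

Lemma add_edge_new (V : finType) (G : sgraph V) u v :
  u != v -> add_edge G u v u v.
Proof. by rewrite /= /add_edge_rel /= => ->; rewrite eqxx orbT. Qed.

Lemma add_edgeE (V : finType) (G : sgraph V) u v x y :
  add_edge G u v x y -> [\/ G x y, x = u /\ y = v | x = v /\ y = u].
Proof.
move=> /= /orP[|/andP[xDy /eqP exy]]; first by constructor 1.
have := set21 x y; have := set22 x y; rewrite exy !inE.
move=> /orP[]/eqP ey /orP[]/eqP ex.
- by rewrite ex ey eqxx in xDy.
- by constructor 3.
- by constructor 2.
- by rewrite ex ey eqxx in xDy.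
Qed.

Lemma copy_through_hom (V W W' : finType) (F : sgraph V) (G : sgraph W)
    (H : sgraph W') (i : W -> W') u v :
  injective i -> (forall x y, G x y -> H (i x) (i y)) ->
  copy_through F G u v -> copy_through F H (i u) (i v).
Proof.
move=> iinj ihom [f [finj fhom [x [y [Fxy fx fy]]]]]; exists (i \o f); split.
- exact: inj_comp.
- by move=> a b /fhom /ihom.
- by exists x, y; rewrite /= fx fy.
Qed.

(** The order in which edges are added is immaterial: an invariant that adding
    edges preserves, and that always leaves an edge to add, suffices.  This avoids
    exhibiting an explicit order. *)
Lemma greedy_saturation (V W : finType) (F : sgraph V) (P : sgraph W -> Prop) :
    (forall G u v, P G -> P (add_edge G u v)) ->
    (forall G x y, P G -> x != y -> ~~ G x y ->
       exists u v, [/\ u != v, ~~ G u v & copy_through F (add_edge G u v) u v]) ->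
  forall G, P G -> weakly_saturated F G.
Proof.
move=> Padd Pstep G; move: {2}#|_|.+1 (ltnSn #|[pred p | ~~ G p.1 p.2]|) => k.
elim: k G => // k IH G; rewrite ltnS => Gk PG.
have [/forallP cG|] := boolP [forall x, forall y, (x != y) ==> G x y].
  by apply: ws_complete => x y xDy; move/forallP/(_ y)/implyP/(_ xDy): (cG x).
rewrite negb_forall => /existsP[x]; rewrite negb_forall => /existsP[y].
rewrite negb_imply => /andP[xDy nGxy].
have [u [v [uDv nGuv cuv]]] := Pstep G x y PG xDy nGxy.
apply: (ws_add uDv nGuv cuv); apply: IH; last exact: Padd.
apply: leq_trans Gk; apply/proper_card/properP; split.
  by apply/fintype.subsetP => -[a b]; rewrite !inE; apply: contra; apply: add_edge_sub.
by exists (u, v); rewrite ?inE //= negbK; apply: (add_edge_new G).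
Qed.

(** A copy of [F] survives in any larger graph, so the process run on [G] can be
    replayed in every [H] containing the image of [G], skipping the edges that are
    already there.  It remains to finish from a graph that is complete on the image
    of [i]. *)
Lemma weakly_saturated_push (V W W' : finType) (F : sgraph V) (i : W -> W') :
    injective i ->
    (forall H : sgraph W', (forall x y, x != y -> H (i x) (i y)) ->
      weakly_saturated F H) ->
  forall G : sgraph W, weakly_saturated F G ->
  forall H : sgraph W', (forall x y, G x y -> H (i x) (i y)) ->
  weakly_saturated F H.
Proof.
move=> iinj Hcompl G; elim=> {G} [G cG H GH|G u v uDv nGuv cuv _ IH H GH].
  by apply: Hcompl => x y /cG /GH.
have [Huv|nHuv] := boolP (H (i u) (i v)).
  apply: IH => x y /add_edgeE[/GH //|[-> ->] //|[-> ->]].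
  by rewrite adj_sym.
have iuDv : i u != i v by rewrite (inj_eq iinj).
have hom x y : add_edge G u v x y -> add_edge H (i u) (i v) (i x) (i y).
  move=> /add_edgeE[/GH/add_edge_sub //|[-> ->]|[-> ->]].
    exact: add_edge_new.
  by rewrite adj_sym; apply: add_edge_new.
apply: (ws_add iuDv nHuv); last exact: IH.
exact: copy_through_hom hom cuv.
Qed.

(** * The weak saturation number is eventually constant *)

Lemma wsat_min n (V : finType) (F : sgraph V) (G : sgraph 'I_n) :
  weakly_saturated F G -> wsat n F <= nb_edges G.
Proof.
move=> wG; rewrite /wsat; case: ex_minnP => m _; apply.
by apply/asboolP; exists G.
Qed.

Lemma wsat_attained n (V : finType) (F : sgraph V) :
  exists2 G : sgraph 'I_n, weakly_saturated F G & nb_edges G = wsat n F.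
Proof.
by rewrite /wsat; case: ex_minnP => m /asboolP[G [wG <-] _]; exists G.
Qed.

Section PushGraph.
Variables (V W : finType) (i : V -> W) (iinj : injective i) (G : sgraph V).

Definition push_rel : rel W :=
  [rel x y | [exists p : V * V, [&& G p.1 p.2, i p.1 == x & i p.2 == y]]].

Lemma push_sym : symmetric push_rel.
Proof.
move=> x y; rewrite /push_rel /=.
by apply/existsP/existsP => -[[a b] /and3P[/= Gab ea eb]];
  exists (b, a); rewrite /= adj_sym Gab ea eb.
Qed.

Lemma push_irr : irreflexive push_rel.
Proof.
move=> x; rewrite /push_rel /=; apply/existsP => -[[a b] /and3P[/= Gab /eqP<-]].
by rewrite (inj_eq iinj) => /eqP eba; rewrite eba adj_irr in Gab.
Qed.

Definition push_graph : sgraph W := SGraph push_sym push_irr.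

Lemma push_graphP x y : G x y -> push_graph (i x) (i y).
Proof.
move=> Gxy; rewrite /= /push_rel /=.
by apply/existsP; exists (x, y); rewrite Gxy !eqxx.
Qed.

Lemma nb_edges_push : nb_edges push_graph <= nb_edges G.
Proof.
apply: leq_trans (leq_imset_card (fun e : {set V} => i @: e) _).
apply/subset_leq_card/fintype.subsetP => e /imsetP[[x y]].
rewrite inE /= /push_rel /= => /existsP[[a b]] /and3P[/= Gab /eqP<- /eqP<-] ->.
apply/imsetP; exists [set a; b].
  by apply/imsetP; exists (a, b); rewrite ?inE.
by rewrite imsetU !imset_set1.
Qed.
End PushGraph.

Lemma injection_two_values (V W : finType) (l q : V) (a b : W) :
  #|V| <= #|W| -> l != q -> a != b ->
  exists f : V -> W, [/\ injective f, f l = a & f q = b].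
Proof.
move=> VW lDq aDb.
pose f0 x : W := enum_val (widen_ord VW (enum_rank x)).
have f0inj : injective f0.
  by move=> x y /enum_val_inj /(congr1 val) /= /val_inj /enum_rank_inj.
pose f1 := tperm (f0 l) a \o f0; pose f := tperm (f1 q) b \o f1.
have f1inj : injective f1 by apply: inj_comp => //; apply: perm_inj.
have f1l : f1 l = a by rewrite /f1 /= tpermL.
exists f; split; first by apply: inj_comp => //; apply: perm_inj.
  rewrite /f /= tpermD ?f1l //; last by rewrite eq_sym.
  by rewrite -f1l (inj_eq f1inj) eq_sym.
by rewrite /f /= tpermL.
Qed.

(** A leaf [l] of [F], with neighbour [q], lets a new vertex be joined to a clique
    that has room for [F] without [l]: the new vertex plays [l] and the other end
    of the added edge plays [q]. *)
Lemma wsat_nonincr (V : finType) (F : sgraph V) (l q : V) n :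
  F l q -> (forall x, F l x -> x = q) -> #|V| <= n.+1 ->
  wsat n.+1 F <= wsat n F.
Proof.
move=> Flq Fl Vn; have [G wG <-] := wsat_attained n F.
have iinj := @lift_inj n.+1 ord_max.
apply: leq_trans (nb_edges_push iinj G); apply: wsat_min.
apply: (weakly_saturated_push iinj _ wG); last exact: push_graphP.
move=> {G wG}.
apply: greedy_saturation => [G u v PG x y xDy|G x y PG xDy nGxy].
  by apply: add_edge_sub; apply: PG.
(* A non-edge has to contain the new vertex, as the others form a clique. *)
wlog ex : x y xDy nGxy / x = ord_max.
  move=> wl; have [x' ex|ex] := unliftP ord_max x; last exact: (wl x y).
  have [y' ey|ey] := unliftP ord_max y.
    case/negP: nGxy; rewrite ex ey PG //; apply: contra xDy => /eqP.
    by rewrite ex ey => ->.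
  by apply: (wl y x) => //; rewrite 1?eq_sym 1?adj_sym // eq_sym.
exists x, y; split=> //.
have lDq : l != q by apply: contraTneq Flq => ->; rewrite adj_irr.
have VW : #|V| <= #|'I_n.+1| by rewrite card_ord.
have [f [finj fl fq]] := injection_two_values VW lDq xDy.
have new := add_edge_new G xDy.
exists f; split=> //; last by exists l, q.
have old z : z != l -> exists z', f z = lift ord_max z'.
  move=> zDl; have [z' ez|ez] := unliftP ord_max (f z); first by exists z'.
  by move: zDl; rewrite -(inj_eq finj) fl ez ex eqxx.
move=> c d Fcd.
have [ec|cDl] := eqVneq c l.
  by subst c; rewrite fl (Fl _ Fcd) fq.
have [ed|dDl] := eqVneq d l.
  by subst d; move: Fcd; rewrite adj_sym => /Fl ->; rewrite fl fq adj_sym.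
apply: add_edge_sub; have [c' ec] := old c cDl; have [d' ed] := old d dDl.
rewrite ec ed PG //; apply: contraTneq Fcd => ecd.
have -> : c = d by apply: finj; rewrite ec ed ecd.
by rewrite adj_irr.
Qed.

Lemma nonincr_stationary (f : nat -> nat) N :
  (forall n, N <= n -> f n.+1 <= f n) ->
  exists w, \forall n \near \oo%classic, f n = w.
Proof.
move=> fN.
have [k] := ubnP (f N); elim: k N fN => // k IH N fN; rewrite ltnS => fNk.
have [const|] := pselect (forall n, N <= n -> f n = f N).
  by exists (f N); exists N.
move=> /existsNP[n] /not_implyP[Nn fnN].
have mono m : f (N + m) <= f N.
  by elim: m => [|m IHm]; rewrite ?addn0 // addnS (leq_trans (fN _ _)) ?leq_addr.
have fn : f n < f N.
  have := mono (n - N); rewrite subnKC // => fnN'.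
  by rewrite ltn_neqAle fnN' andbT; apply/eqP.
by apply: (IH n) => [m nm|]; [apply/fN/leq_trans/nm | apply: leq_trans fNk].
Qed.

(** * A lower bound from the degrees of the ends of edges *)

(** The invariant of the lower bound, in a recursive form suited to moving a vertex to
    the front: the demand on the vertex of index [i] is [k - i] later neighbours.  The
    base case asks the list to be long enough for the demand to reach [0], without
    which the count of edges would fall short. *)
Fixpoint peels (V : eqType) (e : rel V) (k : nat) (s : seq V) : bool :=
  if s is x :: s' then (k <= count (e x) s') && peels e k.-1 s' else k == 0.

Lemma eq_peels (V : eqType) (e e' : rel V) k s :
  {in s &, e =2 e'} -> peels e k s = peels e' k s.
Proof.
elim: s k => //= x s IH k ee'; rewrite (IH k.-1); last first.
  by move=> y z ys zs; rewrite ee' // inE ?ys ?zs orbT.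
congr ((_ <= _) && _); apply: eq_in_count => y ys.
by rewrite ee' ?inE ?eqxx ?ys ?orbT.
Qed.

Lemma peels_complete (V : eqType) (e : rel V) k s :
    uniq s -> (forall x y, x != y -> e x y) -> k <= (size s).-1 ->
  peels e k s.
Proof.
move=> + ce; elim: s k => [|x s IH] k /=; first by rewrite leqn0.
move=> /andP[xs us] ks; rewrite (IH _ us) ?andbT; last by lia.
suff /eqP-> : count (e x) s == size s by [].
rewrite -all_count; apply/allP => y ys; apply: ce.
by apply: contraNneq xs => ->.
Qed.

(** A vertex before [u] keeps its index and loses at most one later neighbour, [u]
    itself, which the smaller parameter [k - 1] allows.  A vertex after [u] keeps
    its later neighbours, and its demand is unchanged because its index drops by
    one. *)
Lemma peels_rem (V : eqType) (e e' : rel V) (u : V) k s :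
    (forall x y, x != u -> y != u -> e' x y = e x y) ->
    uniq s -> u \in s -> peels e' k s -> peels e k.-1 (rem u s).
Proof.
move=> ee'; elim: s k => //= x s IH k /andP[xs us] + /andP[ks ps].
have [ex _|xDu] := eqVneq x u.
  rewrite -(@eq_peels _ e') // => y z ys zs; apply: ee'.
    by apply: contraNneq xs; rewrite ex => <-.
  by apply: contraNneq xs; rewrite ex => <-.
rewrite inE eq_sym (negPf xDu) /= => us'.
rewrite IH // andbT -(@eq_in_count _ (e' x)); last first.
  by move=> y; rewrite mem_rem_uniq // => /andP[/= yDu _]; rewrite ee'.
by have := count_rem u (e' x) s; rewrite us' /=; lia.
Qed.

Lemma count_all_uniq (V : finType) (P : pred V) (s : seq V) :
  uniq s -> (forall x, x \in s) -> count P s = #|P|.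
Proof.
move=> us ss; rewrite -size_filter -(card_uniqP _) ?filter_uniq //.
by apply: eq_card => x; rewrite mem_filter ss andbT.
Qed.

(** Going back through the process, from the complete graph to [G], the end of
    the removed edge that has degree at least [d] with it is moved to the front of
    the list. *)
Lemma weakly_saturated_peels (V W : finType) (F : sgraph V) (d : nat)
    (G : sgraph W) :
    (forall x y, F x y -> d <= maxn #|F x| #|F y|) -> d <= #|W| ->
    weakly_saturated F G ->
  exists s, [/\ uniq s, forall x, x \in s & peels G d.-1 s].
Proof.
move=> Fd dW; elim=> {G} [G cG|G u v uDv nGuv cuv _ [s [us ss ps]]].
  exists (enum W); split=> [|x|]; rewrite ?enum_uniq ?mem_enum //.
  by apply: peels_complete; rewrite ?enum_uniq // -cardE -!subn1 leq_sub2r.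
set H := add_edge G u v in cuv ps.
(* The two ends of the new edge are handled alike: [w] is the one of degree at
   least [d]. *)
have front w z : d <= #|H w| -> ~~ G w z ->
    (forall x y, H x y -> [\/ G x y, x = w /\ y = z | x = z /\ y = w]) ->
  exists s, [/\ uniq s, forall x, x \in s & peels G d.-1 s].
  move=> dw nGwz HE; exists (w :: rem w s); split => /=.
  - by rewrite rem_uniq // andbT mem_rem_uniqF.
  - by move=> x; rewrite inE mem_rem_uniq // !inE ss andbT orbN.
  apply/andP; split; last first.
    apply: peels_rem ps => // x y xDw yDw.
    apply/idP/idP => [/HE[//|[xw]|[_ yw]]|/(@add_edge_sub _ _ u v)//].
      by rewrite xw eqxx in xDw.
    by rewrite yw eqxx in yDw.
  rewrite count_rem ss /= adj_irr subn0 count_all_uniq //.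
  have /subset_leq_card : H w \subset [predU1 z & G w].
    apply/fintype.subsetP => x Hwx; apply/predU1P.
    by case: (HE _ _ Hwx) => [|[_]|[wz xw]]; [right | left | left; rewrite xw].
  by rewrite cardU1; lia.
have [f [finj fhom [x [y [Fxy fx fy]]]]] := cuv.
have deg w : #|F w| <= #|H (f w)|.
  rewrite -(fintype.card_image finj (F w)); apply/subset_leq_card/fintype.subsetP => z'.
  by move=> /fintype.imageP[z Fwz ->]; apply: fhom.
have := Fd x y Fxy; rewrite leq_max => /orP[] /leq_trans/(_ (deg _)).
  by rewrite fx => du; apply: (front u v) => // a b; apply: add_edgeE.
rewrite fy => dv; apply: (front v u) => //; first by rewrite adj_sym.
by move=> a b /add_edgeE[]; [constructor 1 | constructor 3 | constructor 2].
Qed.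

(** Counting each edge at the one of its ends that comes first in the list gives at
    least [k + (k - 1) + ... + 1] edges. *)
Lemma peels_edges (V : finType) (G : sgraph V) k s :
    uniq s -> peels G k s ->
  'C(k.+1, 2) <= #|[set e in edges G | e \subset s]|.
Proof.
elim: s k => [|x s IH] k /=; first by move=> _ /eqP->.
move=> /andP[xs us] /andP[kx /(IH _ us) {}IH].
set A := [set e in edges G | e \subset s] in IH.
pose B := [set [set x; y] | y in [set y in s | G x y]].
have BE : #|B| = count (G x) s.
  rewrite card_in_imset => [|y z].
    rewrite -size_filter -(card_uniqP _) ?filter_uniq //.
    by apply: eq_card => y; rewrite inE mem_filter andbC.
  rewrite !inE => /andP[ys _] /andP[zs _] /setP/(_ y).
  rewrite !inE eqxx orbT; case/esym/orP=> /eqP // eyx.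
  by rewrite -eyx ys in xs.
have AB : [disjoint A & B].
  rewrite disjoint_sym -setI_eq0; apply/eqP/setP => e; rewrite !inE.
  apply: contraNF xs => /andP[/imsetP[y _ ->] /andP[_ /fintype.subsetP]].
  by apply; rewrite !inE eqxx.
apply: (@leq_trans (#|A| + #|B|)).
  rewrite BE; apply: leq_trans (leq_add IH kx).
  by case: k {IH kx} => // k; rewrite binS bin1.
rewrite -cardsUI (disjoint_setI0 AB) cards0 addn0.
apply/subset_leq_card/fintype.subsetP => e; rewrite !inE => /orP[/andP[-> es]|].
  by apply/fintype.subsetP => y /(fintype.subsetP es) ys; rewrite inE ys orbT.
move=> /imsetP[y]; rewrite inE => /andP[ys Gxy] ->; apply/andP; split.
  by apply/imsetP; exists (x, y); rewrite ?inE.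
by apply/fintype.subsetP => z; rewrite !inE => /orP[]/eqP->; rewrite ?eqxx ?ys ?orbT.
Qed.

Lemma weakly_saturated_lower_bound (V W : finType) (F : sgraph V) (d : nat)
    (G : sgraph W) :
    (forall x y, F x y -> d <= maxn #|F x| #|F y|) -> d <= #|W| ->
    weakly_saturated F G ->
  'C(d, 2) <= nb_edges G.
Proof.
case: d => // d Fd dW /(weakly_saturated_peels Fd dW)[s [us _]].
move=> /(peels_edges us) /leq_trans; apply.
by apply/subset_leq_card/fintype.subsetP => e; rewrite inE => /andP[].
Qed.

(** * Trees given by a parent function *)

Section ParentTree.
Variables (p : nat -> nat) (K : nat).

Definition parent_rel : rel 'I_K :=
  [rel i j : 'I_K | (i < j) && (i == p j :> nat) || (j < i) && (j == p i :> nat)].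

Lemma parent_sym : symmetric parent_rel.
Proof. by move=> i j; rewrite /parent_rel /= orbC. Qed.

Lemma parent_irr : irreflexive parent_rel.
Proof. by move=> i; rewrite /parent_rel /= ltnn. Qed.

Definition parent_tree : sgraph 'I_K := SGraph parent_sym parent_irr.

Lemma parent_treeE (i j : 'I_K) :
  parent_tree i j = (i < j) && (i == p j :> nat) || (j < i) && (j == p i :> nat).
Proof. by []. Qed.

Hypothesis p_lt : forall i, 0 < i -> p i < i.

Lemma parent_tree_connected (i j : 'I_K) : connect parent_tree i j.
Proof.
have K0 : 0 < K by apply: leq_ltn_trans (ltn_ord i).
have root n (nK : n < K) : connect parent_tree (Ordinal K0) (Ordinal nK).
  elim/ltn_ind: n nK => n IH nK; have [n0|n0] := posnP n.
    by rewrite (_ : Ordinal nK = Ordinal K0) //; apply: val_inj.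
  apply: connect_trans (IH _ (p_lt n0) (ltn_trans (p_lt n0) nK)) (connect1 _).
  by rewrite parent_treeE /= p_lt ?eqxx.
apply: (connect_trans (y := Ordinal K0)); last by case: j => j jK; apply: root.
by rewrite (sym_connect_sym parent_sym); case: i => i iK; apply: root.
Qed.

(** In a cycle of length at least 3, the largest vertex would have two distinct
    smaller neighbours, both equal to its parent. *)
Lemma parent_tree_acyclic : acyclic parent_tree.
Proof.
case=> // x0 c0 /andP[].
have [m mc mmax] : exists2 m, m \in x0 :: c0 & forall i, i \in x0 :: c0 -> i <= m.
  case: (arg_maxnP (fun i : 'I_K => i : nat) (mem_head x0 c0)) => m mc mmax.
  by exists m.
move: mc mmax; set c := x0 :: c0 => mc mmax cyc uc; clearbody c.
have [k [s rs]] : exists k s, rot k c = m :: s.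
  by case/rot_to: mc => k s e; exists k, s.
rewrite -(size_rot k); rewrite -(rot_cycle k) rs in cyc.
rewrite -(rot_uniq k) rs /= in uc; case/andP: uc => ms us.
have up i : i \in s -> parent_tree m i -> i = p m :> nat.
  move=> is_; have := mmax i; rewrite -(mem_rot k) rs inE is_ orbT => /(_ isT) im.
  by rewrite parent_treeE ltnNge im /= => /andP[_ /eqP].
rewrite rs /= {rs} ; case: s cyc ms us up => [|y [|z s]] //=.
rewrite rcons_path => /and3P[my _] /andP[_ lm] _ /andP[yzs _] up.
case/negP: yzs; rewrite (_ : y = last z s) ?mem_last //; apply: val_inj => /=.
rewrite (up y) ?mem_head // (up (last z s)) //; first by rewrite inE mem_last orbT.
by rewrite parent_sym.
Qed.

Lemma parent_treeP : 0 < K -> is_tree parent_tree.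
Proof.
move=> K0; split; rewrite ?card_ord //.
- exact: parent_tree_connected.
- exact: parent_tree_acyclic.
Qed.

Lemma parent_tree_hom (W : finType) (H : sgraph W) (f : nat -> W) :
    (forall i, 0 < i < K -> H (f (p i)) (f i)) ->
  forall i j : 'I_K, parent_tree i j -> H (f i) (f j).
Proof.
move=> fH i j; rewrite parent_treeE => /orP[] /andP[ij /eqP e].
  by rewrite e; apply: fH; rewrite ltn_ord (leq_ltn_trans _ ij).
by rewrite adj_sym e; apply: fH; rewrite ltn_ord (leq_ltn_trans _ ij).
Qed.
End ParentTree.

(** The last vertex of the numbering is a leaf. *)
Lemma parent_tree_wsat_limit (p : nat -> nat) (K : nat) :
    (forall i, 0 < i -> p i < i) -> 1 < K ->
  exists w, wsat_limit (parent_tree p K) w.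
Proof.
case: K => [|[|K]] // p_lt _; apply: (@nonincr_stationary _ K.+2) => n Kn.
have pK : p K.+1 < K.+2 by rewrite ltnW // ltnS p_lt.
apply: (@wsat_nonincr _ _ ord_max (Ordinal pK)).
- by rewrite parent_treeE /= p_lt ?eqxx ?orbT.
- move=> i; rewrite parent_treeE /= ltnNge -ltnS ltn_ord /= => /andP[_ /eqP e].
  exact: val_inj.
by rewrite card_ord ltnW.
Qed.

(** * Double stars *)

(** Vertex [0] is adjacent to [1, ..., m + 1] and vertex [1] to
    [m + 2, ..., K - 1].  The boolean [m.+1 < i] is read as the parent [0] or [1]. *)
Definition double_star (m K : nat) : sgraph 'I_K :=
  parent_tree (fun i => (m.+1 < i) : nat) K.

Lemma double_star_parent m i : 0 < i -> (m.+1 < i : nat) < i.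
Proof. by lia. Qed.

Lemma double_star_degrees m K x y :
    m.+1.*2 <= K -> double_star m K x y ->
  m.+1 <= maxn #|double_star m K x| #|double_star m K y|.
Proof.
move=> mK.
have deg0 (c : 'I_K) : c = 0 :> nat -> m.+1 <= #|double_star m K c|.
  move=> c0; have ltK (i : 'I_m.+1) : i.+1 < K by have := ltn_ord i; lia.
  pose g i := Ordinal (ltK i).
  have ginj : injective g by move=> i j /(congr1 val) [] /val_inj.
  rewrite -[X in X <= _]card_ord -(fintype.card_image ginj 'I_m.+1).
  apply/subset_leq_card/fintype.subsetP => _ /fintype.imageP[i _ ->].
  rewrite -[_ \in _]/(double_star m K c (g i)) parent_treeE /= c0.
  by have := ltn_ord i; lia.
have deg1 (c : 'I_K) : c = 1 :> nat -> m.+1 <= #|double_star m K c|.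
  move=> c1; have ltK (i : 'I_m.+1) : (if i == 0 :> nat then 0 else i + m.+1) < K.
    by have := ltn_ord i; case: ifP; lia.
  pose g i := Ordinal (ltK i).
  have ginj : injective g.
    by move=> i j /(congr1 val) /= e; apply: val_inj => /=; move: e; do 2 case: ifP; lia.
  rewrite -[X in X <= _]card_ord -(fintype.card_image ginj 'I_m.+1).
  apply/subset_leq_card/fintype.subsetP => _ /fintype.imageP[i _ ->].
  rewrite -[_ \in _]/(double_star m K c (g i)) parent_treeE /= c1.
  by have := ltn_ord i; case: ifP; lia.
rewrite parent_treeE leq_max => /orP[]/andP[_ /eqP].
  by case: (m.+1 < y) => e; rewrite ?(deg1 x e) ?(deg0 x e).
by case: (m.+1 < x) => e; rewrite ?(deg1 y e) ?(deg0 y e) orbT.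
Qed.

(** When [w] is adjacent to all the vertices, it can play the large centre
    whatever the rest of the copy is; then the new edge [x y] makes [x] a small
    centre as soon as [x] has [m - 1] other neighbours. *)
Lemma double_star_copy (W : finType) (G : sgraph W) (w x y : W) m K :
    (forall z, z != w -> G w z) -> x != w -> y != w -> x != y ->
    m.-1 <= #|[set z | G x z && (z \notin [:: w; y])]| ->
    0 < m -> 2 < K <= #|W| ->
  copy_through (double_star m K) (add_edge G x y) x y.
Proof.
move=> Gw xDw yDw xDy; set S := [set _ | _] => mS m0 /andP[K2 KW].
set R := [set z | (z \notin [:: x; w; y]) && (z \notin S)].
(* Vertex [i] of the double star is sent to the entry [i] of [s]: the other leaves
   at the small centre are taken from [S]. *)
pose s := [:: x, w, y & enum S ++ enum R].
have xS : x \notin S by rewrite inE adj_irr.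
have wS : w \notin S by rewrite !inE eqxx andbF.
have yS : y \notin S by rewrite !inE eqxx orbT andbF.
have us : uniq s.
  have [xR wR yR] : [/\ x \notin R, w \notin R & y \notin R].
    by split; rewrite inE !in_cons eqxx ?orbT.
  rewrite /= !in_cons !mem_cat !mem_enum (negPf xS) (negPf wS) (negPf yS).
  rewrite (negPf xR) (negPf wR) (negPf yR) (negPf xDw) (negPf xDy) eq_sym (negPf yDw).
  rewrite cat_uniq !enum_uniq andbT /=.
  apply/hasPn => z; rewrite mem_enum finset.in_set => /andP[_ zS].
  by rewrite /= mem_enum.
have ss z : z \in s.
  rewrite !(in_cons, mem_cat, mem_enum) [z \in R]finset.in_set !in_cons in_nil.
  by do 3 case: (z == _) => //=; case: (z \in S).
have sizes : K <= size s.
  by rewrite -(card_uniqP us) (@eq_card _ _ W).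
pose f (i : nat) := nth x s i.
exists (fun i : 'I_K => f i); split.
- move=> i j /eqP; rewrite nth_uniq // => [/eqP/val_inj //||];
    by apply: leq_trans sizes.
- apply: parent_tree_hom => i /andP[i0 iK].
  have [ia|ia] := ltnP m.+1 i.
    apply: add_edge_sub; apply: Gw; rewrite (_ : w = f 1) // nth_uniq //; try lia.
    exact: leq_trans sizes.
  case: i i0 iK ia => [|[|[|i]]] //= _ iK im.
  + by apply: add_edge_sub; rewrite adj_sym Gw.
  + exact: add_edge_new.
  apply: add_edge_sub; rewrite /f /= nth_cat -cardE.
  have iS : i < #|S| by lia.
  rewrite iS; have : nth x (enum S) i \in S by rewrite -mem_enum mem_nth -?cardE.
  by rewrite inE => /andP[].
exists (Ordinal (ltnW (ltnW K2))), (Ordinal K2); split=> //.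
by rewrite parent_treeE /=; lia.
Qed.

(** * A small weakly saturated graph *)

Section Seed.
Variables (m K n : nat).

(** Vertex [0] is the hub.  Its degree [K] lets it keep the leaves of a large centre
    while another vertex of the clique [0, ..., m + 1] plays the small centre with
    leaves in the clique. *)
Definition seed_rel : rel 'I_n.+1 :=
  [rel x y : 'I_n.+1 | (x != y) &&
    [|| (x <= m.+1) && (y <= m.+1), (x == 0 :> nat) && (y <= K)
      | (y == 0 :> nat) && (x <= K)]].

Lemma seed_sym : symmetric seed_rel.
Proof.
move=> x y; rewrite /seed_rel /= eq_sym andbC.
by rewrite [X in _ || X]orbC [X in X || _]andbC andbC.
Qed.

Lemma seed_irr : irreflexive seed_rel.
Proof. by move=> x; rewrite /seed_rel /= eqxx. Qed.

Definition seed : sgraph 'I_n.+1 := SGraph seed_sym seed_irr.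

Lemma seedE x y : seed x y = (x != y) &&
    [|| (x <= m.+1) && (y <= m.+1), (x == 0 :> nat) && (y <= K)
      | (y == 0 :> nat) && (x <= K)].
Proof. by []. Qed.

Lemma card_ord_le k : #|[set x : 'I_n.+1 | x <= k]| <= k.+1.
Proof.
rewrite -[X in _ <= X]card_ord -cardsT.
apply: leq_trans (leq_imset_card (fun i : 'I_k.+1 => inord i : 'I_n.+1) _).
apply/subset_leq_card/fintype.subsetP => x; rewrite inE => xk.
apply/imsetP; exists (inord x); rewrite // inordK ?ltnS //.
by apply: val_inj; rewrite /= inordK.
Qed.

Lemma nb_edges_seed : nb_edges seed <= m.+2 ^ 2 + K.+1.
Proof.
pose below k := [set x : 'I_n.+1 | x <= k].
pose P := finset.setX (below m.+1) (below m.+1) :|: finset.setX [set ord0] (below K).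
have : edges seed \subset (fun p => [set p.1; p.2]) @: P.
  apply/fintype.subsetP => e /imsetP[[x y]]; rewrite inE seedE /=.
  move=> /andP[_ /or3P[]/andP[xm ym]] ->.
  - by apply/imsetP; exists (x, y); rewrite // !inE /= xm ym.
  - apply/imsetP; exists (x, y); rewrite // !inE /= ym.
    by rewrite (_ : x == ord0) ?orbT.
  apply/imsetP; exists (y, x); rewrite 1?finset.setUC // !inE /= ym.
  by rewrite (_ : y == ord0) ?orbT.
move=> /subset_leq_card /leq_trans; apply.
apply: leq_trans (leq_imset_card _ _) _; apply: leq_trans (leq_card_setU _ _) _.
rewrite !cardsX cards1 mul1n; apply: leq_add (card_ord_le _).
by apply: leq_mul; apply: card_ord_le.
Qed.

Lemma seed_weakly_saturated :
    0 < m -> m.+1.*2 <= K -> K <= n ->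
  weakly_saturated (double_star m K) seed.
Proof.
move=> m0 mK Kn.
pose contains_seed (G : sgraph 'I_n.+1) := forall x y, seed x y -> G x y.
apply: (@greedy_saturation _ _ _ contains_seed) => [G u v sG x y|G x0 y0 sG xDy nGxy|//].
  by move=> /sG; apply: add_edge_sub.
(* The hub is not yet adjacent to all the vertices: vertices [1] and [0] of the
   seed play the two centres, and the new neighbour [y] replaces the leaf [K - 1]. *)
have [/existsP[y /andP[yD0 nG0y]]|] := boolP [exists y, (y != ord0) && ~~ G ord0 y].
  exists ord0, y; split; rewrite 1?eq_sym //.
  have yK : K < y.
    rewrite ltnNge; apply: contra nG0y => yK; apply: sG.
    by rewrite seedE eq_sym yD0 yK orbT.
  pose g i :=
    if i == 0 then 1 else if i == 1 then 0 else if i == K.-1 then y : nat else i.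
  have gn i : i < K -> g i < n.+1.
    by rewrite /g; have := ltn_ord y; do !case: eqP => ?; lia.
  pose f i : 'I_n.+1 := inord (g i).
  have fE i : i < K -> f i = g i :> nat by move=> iK; rewrite inordK ?gn.
  exists (fun i : 'I_K => f i); split.
  - move=> i j /(congr1 val) /=; rewrite !fE // => gij; apply: val_inj.
    move: gij; have := ltn_ord i; have := ltn_ord j; rewrite /g /=.
    by do !case: eqP => ?; lia.
  - apply: parent_tree_hom => i /andP[i0 iK].
    have gpi : g (m.+1 < i) = (i <= m.+1) :> nat by rewrite /g; case: ltnP.
    have gi := fE i iK; have gp := fE _ (ltn_trans (double_star_parent m i0) iK).
    rewrite gpi in gp.
    have [eiK|niK] := eqVneq i K.-1.
      have -> : f i = y.
        by apply: val_inj; rewrite /= gi /g eiK eqxx; do !case: eqP => ?; lia.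
      have -> : f (m.+1 < i) = ord0 by apply: val_inj; rewrite /= gp; case: leqP; lia.
      by apply: add_edge_new; rewrite eq_sym.
    have {}gi : f i = (if i == 1 then 0 else i) :> nat.
      by rewrite gi /g (negPf niK) eqn0Ngt i0.
    apply/add_edge_sub/sG; rewrite seedE -val_eqE /= gi gp.
    by case: (leqP i m.+1) => im; case: (eqVneq i 1) => ? /=; lia.
  have K1 : 1 < K by lia.
  have KK : K.-1 < K by lia.
  exists (Ordinal K1), (Ordinal KK); split.
  + by rewrite parent_treeE /=; lia.
  + by apply: val_inj; rewrite /= fE.
  by apply: val_inj; rewrite /= fE // /g eqxx; do !case: eqP => ?; lia.
rewrite negb_exists => /forallP G0.
have {G0}G0 z : z != ord0 -> G ord0 z.
  by move=> z0; have := G0 z; rewrite z0 /= negbK.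
(* Pick a non-edge at a vertex of the clique if there is one, and any non-edge
   otherwise: in both cases [x] is adjacent to the rest of the clique. *)
have [x [y [xDy' nG Gx]]] : exists x y, [/\ x != y, ~~ G x y &
    forall z : 'I_n.+1, 0 < z <= m.+1 -> z != x -> G x z].
  have [/existsP[x /existsP[y /and4P[x_gt0 xm xy nG]]]|none] :=
    boolP [exists x : 'I_n.+1, exists y : 'I_n.+1, [&& 0 < x, x <= m.+1, x != y & ~~ G x y]].
    exists x, y; split=> // z /andP[z0 zm] zx; apply: sG.
    by rewrite seedE eq_sym zx xm zm.
  exists x0, y0; split=> // z /andP[z0 zm] zx; apply: contraNT none => nGz.
  apply/existsP; exists z; apply/existsP; exists x0.
  by rewrite z0 zm zx adj_sym.
have xD0 : x != ord0 by apply: contraNneq nG => ex; rewrite ex G0 // -ex eq_sym.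
have y0' : y != ord0 by apply: contraNneq nG => ey; rewrite adj_sym ey G0 // -ey.
exists x, y; split => //; apply: double_star_copy G0 xD0 y0' _ _ _ _ => //; last first.
  by rewrite card_ord; lia.
pose A := [set z : 'I_n.+1 | 0 < z <= m.+1].
have cA : m.+1 <= #|A|.
  have ltn' (i : 'I_m.+1) : i.+1 < n.+1 by have := ltn_ord i; lia.
  pose g i := Ordinal (ltn' i).
  have ginj : injective g by move=> i j /(congr1 val) [] /val_inj.
  rewrite -[X in X <= _]card_ord -(fintype.card_image ginj 'I_m.+1).
  apply/subset_leq_card/fintype.subsetP => _ /fintype.imageP[i _ ->].
  by rewrite inE /=; have := ltn_ord i; lia.
have : #|A :\: [set x; y]| <= #|[set z | G x z && (z \notin [:: ord0; y])]|.
  apply/subset_leq_card/fintype.subsetP => z; rewrite !inE negb_or.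
  case/andP=> /andP[zx zy] /andP[z0 zm]; rewrite Gx ?z0 //= negb_or zy andbT.
  by rewrite -val_eqE /= -lt0n.
apply: leq_trans; have := cardsID [set x; y] A.
have : #|A :&: [set x; y]| <= 2.
  apply: leq_trans (subset_leq_card (finset.subsetIr _ _)) _.
  by rewrite cards2; case: (x != y).
have arith a b c : m < c -> a <= 2 -> a + b = c -> m.-1 <= b by lia.
by move=> AI2 AID; apply: arith cA AI2 AID.
Qed.
End Seed.

(** * The order of magnitude *)

Lemma double_star_wsat_bounds m K w :
    0 < m -> m.+1.*2 <= K -> wsat_limit (double_star m K) w ->
  'C(m.+1, 2) <= w <= m.+2 ^ 2 + K.+1.
Proof.
move=> m0 mK [N _ wN].
have [n Nn Kn] : exists2 n, N <= n.+1 & K <= n by exists (maxn N K); lia.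
rewrite -(wN n.+1 Nn); apply/andP; split.
  have [G wG <-] := wsat_attained n.+1 (double_star m K).
  apply: weakly_saturated_lower_bound wG; last by rewrite card_ord; lia.
  by move=> x y; apply: double_star_degrees.
apply: leq_trans (nb_edges_seed m K n).
exact/wsat_min/seed_weakly_saturated.
Qed.

Import Order.TTheory GRing.Theory Num.Theory.
Import numFieldNormedType.Exports.
Local Open Scope classical_set_scope.
Local Open Scope ring_scope.

Theorem theorem1p2 (R : realType) (alpha : R)
    (halpha : 1 <= alpha <= 2) :
  exists (T : forall K : nat, sgraph 'I_K) (w : nat -> nat),
    (forall K : nat, (5 <= K)%N ->
       is_tree (T K) /\ wsat_limit (T K) (w K)) /\
    (fun K : nat => (w K)%:R : R) =Theta_\oo
      (fun K : nat => K%:R `^ alpha).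
Proof.
case/andP: halpha => a1 a2.
pose r (K : nat) : R := K%:R `^ (alpha / 2).
pose m K := Num.truncn (r K / 4).
have /choice[w wlim] K : exists w,
    (1 < K)%N -> wsat_limit (double_star (m K) K) w.
  have [K1|_] := ltnP 1 K; last by exists 0%N.
  have [w ww] := parent_tree_wsat_limit (@double_star_parent (m K)) K1.
  by exists w.
exists (fun K => double_star (m K) K), w; split=> [K K5|].
  split; last by apply: wlim; apply: leq_trans K5.
  by apply: parent_treeP; [exact: double_star_parent | apply: leq_trans K5].
(* With [r = K ^ (alpha / 2) >= 8], one has [r / 8 <= m <= r / 4], whence the lower
   bound [m ^ 2 / 2 >= r ^ 2 / 128], and the upper one from [m + 2 <= r] and
   [K + 1 <= 2 r ^ 2]. *)
rewrite eqThetaE qualifE; apply/asboolP; exists (128^-1, 3); first by rewrite /=; lra.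
exists 64%N => // K /= K64.
have K64R : 64 <= K%:R :> R by rewrite (ler_nat _ 64).
have r2 : K%:R `^ alpha = r K ^+ 2.
  rewrite /r expr2 -powRD; last by apply/implyP => _; rewrite pnatr_eq0; lia.
  by congr (_ `^ _); lra.
have rge8 : 8 <= r K.
  have -> : 8 = 64 `^ (2^-1) :> R.
    by rewrite powR12_sqrt // (_ : 64 = 8 ^+ 2) ?sqrtr_sqr ?ger0_norm //; lra.
  apply: (@le_trans _ _ (K%:R `^ 2^-1)).
    by rewrite ge0_ler_powR ?nnegrE //; lra.
  by apply: ler_powR; lra.
have rleK : r K <= K%:R by rewrite /r ler1_powR //; lra.
have Kler2 : K%:R <= r K ^+ 2 by rewrite -r2 le1r_powR //; lra.
have /andP[mr rm] : (m K)%:R <= r K / 4 < (m K).+1%:R by apply: truncn_itv; lra.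
rewrite -[(m K).+1%:R]natr1 in rm.
have m0 : (0 < m K)%N by rewrite -(ltr_nat R); lra.
have mK : ((m K).+1.*2 <= K)%N.
  by rewrite -(ler_nat R) -muln2 natrM -[(m K).+1%:R]natr1; lra.
have /andP[] := double_star_wsat_bounds m0 mK (wlim K (@leq_trans 64 2 K isT K64)).
rewrite -(ler_nat R) => lo; rewrite -(ler_nat R) => hi.
have bin : 'C((m K).+1, 2)%:R * 2 = (m K)%:R * ((m K)%:R + 1) :> R.
  rewrite natr1 -!natrM; congr _%:R.
  by rewrite mulnC -mul_bin_diag bin1 mulnC.
have nr : `|r K ^+ 2| = r K ^+ 2 by rewrite ger0_norm ?sqr_ge0.
have nw : `|(w K)%:R| = (w K)%:R :> R by rewrite ger0_norm.
rewrite r2 [`|r K ^+ 2|]nr [`|(w K)%:R|]nw.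
rewrite natrD natrX -[K.+1%:R]natr1 -[(m K).+2%:R]natr1 -[(m K).+1%:R]natr1 in hi.
have rr : 8 * r K <= r K ^+ 2 by rewrite expr2 ler_wpM2r //; lra.
split=> /=.
  apply: le_trans lo; nra.
nra.
Qed.
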